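(* For every integer $r\geq 2$ we have $\mathrm{F}(2,r)\leq 2^{2r}-2^{r-1}-1$.
   Context: For a prime power $q$ and positive integer $r$, $\operatorname{LPD}(q,r)$ denotes the set of positive integers $n$ for which there exists, for some $k$, a projective $q^r$-divisible linear $[n,k]$ code over $\mathbb{F}_q$; here a code is $q^r$-divisible if every codeword's Hamming weight is divisible by $q^r$, and projective if the columns of a generating matrix are nonzero and pairwise not scalar multiples of each other. $\mathrm{F}(q,r)$ denotes the largest positive integer not contained in $\operatorname{LPD}(q,r)$ (this set contains all but finitely many positive integers). *)

(* Defs.v *)
From HB Require Import structures.
From mathcomp Require Import all_boot all_order all_algebra.

Set Implicit Arguments.
Unset Strict Implicit.
Unset Printing Implicit Defensive.

Import GRing.Theory.
Local Open Scope ring_scope.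

(* A linear [n, k] code over F is a subspace C : {vspace 'rV[F]_n} with
   \dim C = k. The field F_q is represented by a finFieldType F, with
   q = #|F|. *)

Definition hamming_weight (F : finFieldType) (n : nat) (c : 'rV[F]_n) : nat :=
  #|[set j | c 0 j != 0]|.

Definition divisible_code (F : finFieldType) (n d : nat)
    (C : {vspace 'rV[F]_n}) : Prop :=
  forall c, c \in C -> (d %| hamming_weight c)%N.

Definition generator_matrix (F : finFieldType) (n k : nat)
    (G : 'M[F]_(k, n)) (C : {vspace 'rV[F]_n}) : Prop :=
  row_free G /\ forall c : 'rV[F]_n, (c \in C) = (c <= G)%MS.

(* Two generator matrices of C differ by left multiplication by an invertible
   matrix, so the choice of G is immaterial. *)
Definition projective_code (F : finFieldType) (n : nat)
    (C : {vspace 'rV[F]_n}) : Prop :=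
  exists G : 'M[F]_(\dim C, n),
    [/\ generator_matrix G C,
        forall j, col j G != 0
      & forall i j, i != j -> forall a : F, col i G != a *: col j G].

Definition LPD (F : finFieldType) (r n : nat) : Prop :=
  (0 < n)%N /\
  exists (k : nat) (C : {vspace 'rV[F]_n}),
    [/\ \dim C = k, projective_code C & divisible_code (#|F| ^ r) C].

(* is_largest_non_LPD F r m renders "m = F(q, r)". *)
Definition is_largest_non_LPD (F : finFieldType) (r m : nat) : Prop :=
  [/\ (0 < m)%N, ~ LPD F r m
    & forall n : nat, (0 < n)%N -> ~ LPD F r n -> (n <= m)%N].

(* Main.v *)
(** Let q = 2^r and let p_i (i in I, #|I| = M) be nonzero vectors of F_q^d such
    that every linear form u is nonzero on an even number of the p_i. Fix a
    nonzero additive map tau : F_q -> F_2. The binary words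
    (i, z) |-> b_i + tau (z * u(p_i)), with b_i in F_2 arbitrary, form a
    q-divisible code of length q * M: the block of i has weight q/2 if
    u(p_i) != 0, and 0 or q otherwise. If p_i, i in Z, are pairwise not
    proportional, then shortening at the positions (i, 0), i in Z, keeps the
    code projective, so that q * M - #|Z| is a length.

    Three kinds of families, and their direct sums, are enough: a repeated
    vector (M = 2, #|Z| <= 1), a projective line (M = q + 1, #|Z| <= q + 1) and
    a hyperoval in the projective plane (M = q + 2, #|Z| <= q + 2). Writing
    n = q * M - s with s < q, pairs alone handle M = q (then s <= q/2 is
    needed, which is where the bound comes from), the line plus pairs handles
    odd M > q, and the hyperoval plus pairs even M > q. *)

Require Import Defs.
From mathcomp Require Import all_boot all_order all_algebra all_field.
From mathcomp Require Import zify ring.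
From Stdlib Require Import Classical.

Set Implicit Arguments.
Unset Strict Implicit.
Unset Printing Implicit Defensive.

Import GRing.Theory.
Local Open Scope ring_scope.

(** * Projectivity and divisibility of binary codes *)

Lemma F2_cases (a : 'F_2) : a = 0 \/ a = 1.
Proof.
case: a => [[|[|m]] hm]; [left | right | by []]; exact: val_inj.
Qed.

(** The only scalars are 0 and 1, so the columns must be nonzero and pairwise distinct. A column of
    [G] determines its coordinate in every codeword, so codewords that tell positions apart tell
    columns apart. *)
Lemma separated_projective_code n (C : {vspace 'rV['F_2]_n}) :
    (forall j, exists2 c, c \in C & c 0 j != 0) ->
    (forall i j, i != j -> exists2 c, c \in C & c 0 i != c 0 j) ->
  projective_code C.
Proof.
move=> Cnz Csep.
pose G := \matrix_(i < \dim C) (vbasis C)`_i.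
have GE c : c \in C -> c = (\row_i coord (vbasis C) i c) *m G.
  move=> cC; rewrite {1}(coord_vbasis cC) mulmx_sum_row.
  by apply: eq_bigr => i _; rewrite mxE rowK.
have colE k c : c \in C ->
    c 0 k = ((\row_i coord (vbasis C) i c) *m col k G) 0 0.
  move=> /GE {1}->; rewrite !mxE; apply: eq_bigr => i _.
  by rewrite !mxE.
exists G; split.
- split.
    apply/inj_row_free => v vG0.
    have /freeP fr := basis_free (vbasisP C).
    apply/rowP=> i; rewrite mxE; apply: (fr (fun i => v 0 i)).
    rewrite -[RHS]vG0 mulmx_sum_row; apply: eq_bigr => k _.
    by rewrite rowK.
  move=> c; apply/idP/idP => [cC | /submxP[D ->]].
    by apply/submxP; exists (\row_i coord (vbasis C) i c); exact: GE.
  rewrite mulmx_sum_row; apply: rpred_sum => i _; apply: rpredZ.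
  by rewrite rowK; apply/vbasis_mem/mem_nth; rewrite size_tuple.
- move=> j; have [c cC] := Cnz j; apply: contraNneq => Gj0.
  by rewrite (colE j c cC) Gj0 mulmx0 mxE.
- move=> i j neq_ij a; case: (F2_cases a) => ->.
    have [c cC] := Cnz i; apply: contraNneq => Gi0.
    by rewrite (colE i c cC) Gi0 scale0r mulmx0 mxE.
  have [c cC] := Csep i j neq_ij; apply: contraNneq => Gij.
  by rewrite (colE i c cC) Gij scale1r -colE.
Qed.

(** Words closed under addition are their own span over [F_2], so divisibility need only be checked
    on them. Different indices in [P] may give the same word. *)
Lemma LPD_of_words (r : nat) (T P : finType) (w : P -> T -> 'F_2) :
    (0 < #|T|)%N ->
    (forall p p', exists p'', forall t, w p'' t = w p t + w p' t) ->
    (forall p, (2 ^ r %| #|[set t | (w p t != 0)%R]|)%N) ->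
    (forall t, exists p, w p t != 0) ->
    (forall t t', t != t' -> exists p, w p t != w p t') ->
  LPD 'F_2 r #|T|.
Proof.
move=> T_gt0 wD w_div w_nz w_sep; split=> //.
pose c p : 'rV['F_2]_#|T| := \row_j w p (enum_val j).
pose X := in_tuple (map c (enum P)).
have cX p : c p \in X by apply: map_f; rewrite mem_enum.
have cC p : c p \in <<X>>%VS by exact: memv_span.
have cDE p p' : exists p'', c p + c p' = c p''.
  have [p'' w''] := wD p p'; exists p''.
  by apply/rowP=> j; rewrite !mxE w''.
have [p0 c0] : exists p, c p = 0.
  have /card_gt0P[t _] := T_gt0; have [p _] := w_nz t.
  have [p' cp'] := cDE p p; exists p'; rewrite -cp'.
  by apply/rowP=> j; rewrite !mxE addrr_pchar2 ?pchar_Fp.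
have CE v : v \in <<X>>%VS -> exists p, v = c p.
  move/coord_span=> ->; elim/big_ind: _ => [|_ _ [p ->] [p' ->]|i _].
  - by exists p0.
  - by have [p'' ->] := cDE p p'; exists p''.
  have /mapP[p _ ->] : X`_i \in map c (enum P) by rewrite mem_nth ?size_tuple.
  set a := coord _ _ _; case: (F2_cases a) => ->;
    last by rewrite scale1r; exists p.
  by rewrite scale0r; exists p0.
exists (\dim <<X>>%VS), <<X>>%VS; split=> //.
  apply: separated_projective_code => [j | i j neq_ij].
    by have [p wp] := w_nz (enum_val j); exists (c p); rewrite ?mxE.
  have [|p wp] := w_sep (enum_val i) (enum_val j); last first.
    by exists (c p); rewrite ?mxE.
  by apply: contra_neq neq_ij => /enum_val_inj.
rewrite card_Fp // => v /CE[p ->]; apply: dvdn_trans (w_div p) _.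
rewrite /hamming_weight -(card_imset _ (@enum_rank_inj T)).
rewrite (_ : enum_rank @: _ = [set j | c p 0 j != 0]) //.
apply/setP=> j; rewrite inE mxE; apply/imsetP/idP => [[t] | wj].
  by rewrite inE => wt ->; rewrite enum_rankK.
by exists (enum_val j); rewrite ?inE ?enum_valK.
Qed.

(** * Additive maps from [F] to [F_2] *)

(** A coordinate of [F] as an [F_2]-vector space that does not vanish at 1 serves as [tau]. *)
Lemma exists_additive_F2 (F : finFieldType) : 2 \in [pchar F] ->
  exists tau : F -> 'F_2,
    (forall x y, tau (x + y) = tau x + tau y) /\ exists x, tau x = 1.
Proof.
move=> F2; pose L : vectType 'F_2 := pPrimeCharType F2.
pose e := vbasis {:L}.
have [i ci] : exists i, coord e i (1 : L) != 0.
  apply/existsP; apply: contraT; rewrite negb_exists => /forallP c0.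
  have /eqP[] : (1 : F) != 0 by exact: oner_neq0.
  rewrite (coord_vbasis (memvf (1 : L))) big1 // => i _.
  by have := c0 i; rewrite negbK => /eqP ->; rewrite scale0r.
exists (fun x : F => coord e i (x : L)); split=> [x y|].
  exact: (linearD (coord e i) (x : L) (y : L)).
exists 1; have [c0 | //] := F2_cases (coord e i (1 : L)).
by rewrite c0 eqxx in ci.
Qed.

Section WordWeights.

Variables (F : finFieldType) (tau : F -> 'F_2).
Hypothesis tauD : forall x y, tau (x + y) = tau x + tau y.
Hypothesis tau1 : exists x, tau x = 1.

Lemma tau0 : tau 0 = 0.
Proof. by apply: (addrI (tau 0)); rewrite -tauD !addr0. Qed.

(** Translation by [x / a], where [tau x = 1], flips the value and so exchanges the set with its
    complement. *)
Lemma card_affine_neq0 (b : 'F_2) (a : F) : a != 0 ->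
  (#|[set z | (b + tau (z * a) != 0)%R]| * 2 = #|F|)%N.
Proof.
move=> a_neq0; have [x taux] := tau1; set A := [set z | _].
pose s z := z + x / a.
have s_inj : injective s by exact: addIr.
have As z : (s z \in A) = (z \notin A).
  rewrite !inE mulrDl divfK // tauD taux addrA negbK.
  by case: (F2_cases (b + tau (z * a))) => ->.
rewrite muln2 -addnn -(cardsC A); congr (_ + _)%N.
apply/eqP; rewrite eqn_leq; apply/andP; split.
  rewrite -(card_imset _ s_inj); apply/subset_leq_card/subsetP.
  by move=> _ /imsetP[z zA ->]; rewrite inE As negbK.
rewrite -(card_imset _ s_inj); apply/subset_leq_card/subsetP.
by move=> _ /imsetP[z zA ->]; rewrite As -in_setC.
Qed.

Lemma tau_nondegenerate d (v : 'rV[F]_d) : v != 0 ->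
  exists u : 'cV[F]_d, tau ((v *m u) 0 0) != 0.
Proof.
case/rV0Pn => j vj; have [x taux] := tau1.
exists ((x / v 0 j) *: delta_mx j 0); rewrite -scalemxAr -colE !mxE.
by rewrite divfK // taux.
Qed.

End WordWeights.

(** * Codes from point families *)

(* The set Z consists of the blocks that will be shortened by one position. *)
Definition point_family (F : finFieldType) (M s : nat) : Prop :=
  exists (I : finType) (d : nat) (p : I -> 'rV[F]_d) (Z : {set I}),
  [/\ #|I| = M, #|Z| = s, forall i, p i != 0,
      {in Z &, forall i j, i != j -> forall a, p i != a *: p j}
    & forall u : 'cV[F]_d, ~~ odd #|[set i | ((p i *m u) 0 0 != 0)%R]|].

Lemma point_family_LPD (F : finFieldType) (r M s : nat) :
    2 \in [pchar F] -> #|F| = (2 ^ r.+1)%N -> (s < 2 ^ r.+1 * M)%N ->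
  point_family F M s -> LPD 'F_2 r.+1 (2 ^ r.+1 * M - s).
Proof.
move=> F2 cardF lt_s [I [d [p [Z [cardI cardZ p_nz p_ind p_even]]]]].
have [tau [tauD tau1]] := exists_additive_F2 F2.
pose Q (t : I * F) := ~~ ((t.1 \in Z) && (t.2 == 0)).
pose T := {t | Q t}.
have cardT : #|{: T}| = (2 ^ r.+1 * M - s)%N.
  rewrite card_sub -cardI -cardF mulnC -card_prod -(cardC Q) -cardZ.
  rewrite -(card_in_imset (f := fun i : I => (i, 0 : F)) (D := mem Z)).
    rewrite (_ : #|[predC Q]| = #|[set (i, 0 : F) | i in Z]|) ?addnK //.
    apply: eq_card => -[i z]; rewrite !inE negbK /=.
    apply/andP/imsetP => [[iZ /eqP->] | [j jZ [-> ->]]]; last by [].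
    by exists i.
  by move=> i j _ _ [].
(* Forcing the constant to 0 on [Z] makes every word vanish at the deleted positions [(i, 0)], as
   shortening requires. *)
pose b' (b : {ffun I -> 'F_2}) i := if i \in Z then 0 else b i.
pose g (x : {ffun I -> 'F_2} * 'cV[F]_d) (t : I * F) :=
  b' x.1 t.1 + tau (t.2 * (p t.1 *m x.2) 0 0).
(* Position [(i, z)] behaves like the vector [z *: p i]: distinct vectors are separated by some
   [u]. *)
have tau_nd i j (y z : F) : y *: p i != z *: p j ->
    exists u : 'cV_d, tau (y * (p i *m u) 0 0) != tau (z * (p j *m u) 0 0).
  rewrite -subr_eq0 => /(tau_nondegenerate tau1)[u tau_u].
  exists u; apply: contra_neq tau_u; rewrite mulmxBl -!scalemxAl.
  move: (p i *m u) (p j *m u) => A B eq_tau; rewrite !mxE.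
  apply: (addIr (tau (z * B 0 0))).
  by rewrite -tauD subrK add0r.
rewrite -cardT.
apply: (@LPD_of_words _ _ ({ffun I -> 'F_2} * 'cV[F]_d)%type
         (fun x (t : T) => g x (val t))).
- by rewrite cardT subn_gt0.
- move=> [b u] [b1 u1]; exists ([ffun i => b i + b1 i], u + u1) => -[[i z] Qiz].
  rewrite /g /b' /= mulmxDr mxE mulrDr tauD ffunE.
  by case: ifP => _; rewrite ?addr0 ?add0r // addrACA.
- move=> [b u].
  have -> : #|[set t : T | g (b, u) (val t) != 0]| =
            (\sum_i #|[set z | (b' b i + tau (z * (p i *m u) 0 0) != 0)%R]|)%N.
    rewrite -(card_imset _ val_inj) -sum1_card.
    (* Deleted positions carry the value 0, so the weight may be counted over all of [I * F], block
       by block. *)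
    rewrite (eq_bigl (fun t => g (b, u) t != 0)); last first.
      move=> t; apply/imsetP/idP => [[t'] | gt]; first by rewrite inE => ? ->.
      have Qt : Q t.
        apply: contraNN gt => /andP[tZ /eqP t0].
        by rewrite /g /b' tZ t0 mul0r (tau0 tauD) addr0.
      by exists (Sub t Qt); rewrite ?inE.
    rewrite (eq_bigl (fun t : I * F =>
      xpredT t.1 && (g (b, u) (t.1, t.2) != 0))); last by case.
    rewrite -(pair_big_dep xpredT (fun i z => g (b, u) (i, z) != 0)
               (fun _ _ => 1%N)).
    by apply: eq_bigr => i _; rewrite sum1dep_card.
  (* Blocks where the form [u] is nonzero weigh [2 ^ r] each and are even in number; the others are
     constant, of weight 0 or [2 ^ r.+1]. *)
  rewrite (bigID (fun i => (p i *m u) 0 0 != 0)) /= dvdn_add //.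
    rewrite (eq_bigr (fun=> (2 ^ r)%N)) => [|i nz]; last first.
      have := card_affine_neq0 tauD tau1 (b' b i) nz.
      by rewrite cardF expnSr => /eqP; rewrite eqn_pmul2r // => /eqP.
    rewrite sum_nat_cond_const expnS dvdn_pmul2r ?expn_gt0 //.
    by rewrite dvdn2 p_even.
  apply: dvdn_sum => i; rewrite negbK => /eqP->.
  case: (eqVneq (b' b i) 0) => [-> | nz].
    rewrite eq_card0 // => z.
    by rewrite !inE mulr0 (tau0 tauD) addr0 eqxx.
  rewrite (eq_card (B := F)) ?cardF // => z.
  by rewrite !inE mulr0 (tau0 tauD) addr0 nz.
- move=> [[i z] Qiz]; rewrite /Q /= in Qiz *.
  have [iZ | niZ] := boolP (i \in Z); last first.
    exists ([ffun=> 1], 0); rewrite /g /b' /= (negPf niZ) ffunE mulmx0 mxE.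
    by rewrite mulr0 (tau0 tauD).
  rewrite iZ /= in Qiz.
  have [|u tau_u] := tau_nd i i z 0.
    by rewrite scale0r scaler_eq0 negb_or Qiz p_nz.
  by exists (0, u); move: tau_u; rewrite /g /b' /= iZ mul0r (tau0 tauD) add0r.
move=> [[i z] Qi] [[j y] Qj]; rewrite -val_eqE /= xpair_eqE => neq.
have [eq_ij | neq_ij] := eqVneq i j.
  rewrite -{}eq_ij eqxx /= in neq Qj *.
  have [|u tau_u] := tau_nd i i z y.
    by rewrite -subr_eq0 -scalerBl scaler_eq0 negb_or subr_eq0 neq p_nz.
  exists ([ffun=> 0], u); rewrite /g /b' /= ffunE if_same !add0r.
  exact: tau_u.
have [/andP[iZ jZ] | nZ] := boolP ((i \in Z) && (j \in Z)).
  rewrite /Q /= iZ jZ /= in Qi Qj.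
  have [|u tau_u] := tau_nd i j z y.
    apply: contraNneq (p_ind i j iZ jZ neq_ij (z^-1 * y)) => eq_zy.
    by rewrite -scalerA -eq_zy scalerA mulVf ?scale1r.
  by exists (0, u); rewrite /g /b' /= iZ jZ !add0r.
(* At least one of [i], [j] lies outside [Z]; the indicator of that block, with [u = 0], separates
   the two positions. *)
exists ([ffun k => ((k == i) && (i \notin Z) || (k == j) && (i \in Z))%:R], 0).
rewrite /g /b' /= !ffunE !mulmx0 !mxE !mulr0 (tau0 tauD) !addr0 !eqxx.
rewrite (negPf neq_ij) (eq_sym j) (negPf neq_ij) /=.
by case: (i \in Z) nZ => /= [/negPf-> | _]; rewrite ?if_same.
Qed.

(** * Operations on point families, and repeated points *)

Lemma point_family_weaken (F : finFieldType) (M s s' : nat) :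
  (s' <= s)%N -> point_family F M s -> point_family F M s'.
Proof.
move=> le_s [I [d [p [Z [cardI cardZ p_nz p_ind p_even]]]]].
pose Z' := [set i in take s' (enum Z)].
have sZ i : i \in Z' -> i \in Z.
  by rewrite inE => /mem_take; rewrite mem_enum.
exists I, d, p, Z'; split=> //.
  rewrite cardsE (card_uniqP _) ?take_uniq ?enum_uniq // size_takel //.
  by rewrite -cardE cardZ.
by move=> i j /sZ iZ /sZ jZ; exact: p_ind.
Qed.

(** Nonzero vectors from complementary subspaces are never proportional, and a form on the direct
    sum restricts to one form on each summand, so the even counts add up. *)
Lemma point_family_add (F : finFieldType) (M1 s1 M2 s2 : nat) :
    point_family F M1 s1 -> point_family F M2 s2 ->
  point_family F (M1 + M2) (s1 + s2).
Proof.
move=> [I1 [d1 [p1 [Z1 [cI1 cZ1 nz1 ind1 even1]]]]].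
move=> [I2 [d2 [p2 [Z2 [cI2 cZ2 nz2 ind2 even2]]]]].
pose p (i : I1 + I2) : 'rV[F]_(d1 + d2) :=
  match i with inl i1 => row_mx (p1 i1) 0 | inr i2 => row_mx 0 (p2 i2) end.
pose Z := [set i : I1 + I2 |
  match i with inl i1 => i1 \in Z1 | inr i2 => i2 \in Z2 end].
have cardU (P : pred (I1 + I2)) : #|[set i | P i]| =
    (#|[set i | P (inl i)]| + #|[set i | P (inr i)]|)%N.
  by rewrite -!sum1dep_card big_sumType.
exists (I1 + I2)%type, (d1 + d2)%N, p, Z; split.
- by rewrite card_sum cI1 cI2.
- by rewrite cardU -cZ1 -cZ2 !cardsE.
- case=> i /=; apply/eqP; rewrite -row_mx0 => /eq_row_mx[].
    by move/eqP; rewrite (negPf (nz1 i)).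
  by move=> _ /eqP; rewrite (negPf (nz2 i)).
- move=> [i|i] [j|j]; rewrite !inE => iZ jZ neq_ij a;
    apply/eqP; rewrite /= scale_row_mx => /eq_row_mx[].
  + by move/eqP; rewrite (negPf (ind1 i j iZ jZ neq_ij a)).
  + by move/eqP; rewrite scaler0 (negPf (nz1 i)).
  + by move=> _ /eqP; rewrite scaler0 (negPf (nz2 i)).
  by move=> _ /eqP; rewrite (negPf (ind2 i j iZ jZ neq_ij a)).
move=> u; rewrite cardU oddD -(vsubmxK u) /p.
rewrite (eq_card (B := [set i | (p1 i *m usubmx u) 0 0 != 0])); last first.
  by move=> i; rewrite !inE mul_row_col mul0mx addr0.
rewrite [X in _ (+) odd X](eq_card (B := [set i | (p2 i *m dsubmx u) 0 0 != 0])).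
  by rewrite (negPf (even1 _)) (negPf (even2 _)).
by move=> i; rewrite !inE mul_row_col mul0mx add0r.
Qed.

(** A vector listed twice is counted 0 or 2 times by any form, but only one copy may enter [Z]. The
    family is a direct sum of [k] such pairs. *)
Lemma point_family_pairs (F : finFieldType) (k : nat) :
  point_family F (k * 2) k.
Proof.
elim: k => [|k IHk].
  exists void, 0%N, (fun=> 0), set0; split; try by case.
  - by rewrite card_void.
  - by rewrite cards0.
  by move=> u; rewrite (eq_card0 (A := [set _ | _])) //; case.
rewrite mulSn -[k.+1]add1n; apply: point_family_add IHk.
exists bool, 1%N, (fun=> const_mx 1), [set true]; split.
- by rewrite card_bool.
- by rewrite cards1.
- by move=> i; apply/rV0Pn; exists 0; rewrite mxE oner_eq0.
- by move=> i j /set1P-> /set1P->; rewrite eqxx.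
move=> u; set x := (const_mx 1 *m u) 0 0.
rewrite (_ : [set i | _] = if x != 0 then setT else set0).
  by case: ifP => _; rewrite ?cardsT ?card_bool ?cards0.
by apply/setP=> i; rewrite inE; case: ifP; rewrite inE.
Qed.

(** * Lines and hyperovals in characteristic 2 *)

Section Conic.

Variable F : finFieldType.
Hypothesis F2 : 2 \in [pchar F].
Hypothesis F_even : ~~ odd #|F|.

(** Squaring is additive with trivial kernel, hence bijective on the finite field. *)
Lemma sqrt_exists (y : F) : exists x, x ^+ 2 = y.
Proof.
have sq_inj : injective (fun x : F => x ^+ 2).
  move=> x x' /eqP; rewrite -subr_eq0 => /eqP xx'.
  apply/eqP; rewrite -subr_eq0 -sqrf_eq0.
  have -> : (x - x') ^+ 2 =
      x ^+ 2 - x' ^+ 2 + (x' ^+ 2 + x' ^+ 2) - (x * x' + x * x') by ring.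
  by rewrite !addrr_pchar2 // xx' addr0 subr0.
by exists (invF sq_inj y); exact: (f_invF sq_inj).
Qed.

(** If exactly one of [b], [c] is nonzero there is one root, found by division or by a square root.
    If both are nonzero, a root [x] comes with a second root [x + b / c]; if both vanish, the roots
    are none or all of [F]. *)
Lemma odd_card_quadratic_roots (a b c : F) :
  odd #|[set t | a + t * b + t ^+ 2 * c == 0]| = (b != 0) (+) (c != 0).
Proof.
set Z := [set t | _].
have [Z0 | [x]] := set_0Vmem Z.
  rewrite Z0 cards0; apply/esym/negP => bc.
  suff [x] : exists x, x \in Z by rewrite Z0 inE.
  have [c0 | c_nz] := eqVneq c 0.
    rewrite c0 eqxx addbF in bc; exists (- a / b).
    by rewrite inE c0 mulr0 addr0 divfK // subrr.
  rewrite c_nz addbT negbK in bc.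
  have [x x2] := sqrt_exists (- a / c); exists x.
  by rewrite inE (eqP bc) mulr0 addr0 x2 divfK // subrr.
rewrite inE => /eqP fx0.
have fE t : a + t * b + t ^+ 2 * c = (t - x) * (b + (t + x) * c).
  by rewrite -[LHS]subr0 -fx0; ring.
have [c0 | c_nz] := eqVneq c 0.
  have [b0 | b_nz] := eqVneq b 0.
    rewrite (_ : Z = setT) ?cardsT ?(negPf F_even) //.
    by apply/setP=> t; rewrite !inE fE b0 c0 mulr0 addr0 mulr0 eqxx.
  rewrite (_ : Z = [set x]) ?cards1 //.
  apply/setP=> t; rewrite !inE fE c0 mulr0 addr0 mulf_eq0 subr_eq0.
  by rewrite (negPf b_nz) orbF.
have eqx t : b + (t + x) * c = (t - (x + b / c)) * c.
  rewrite mulrBl [(x + _) * c]mulrDl divfK // opprD !oppr_pchar2 //.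
  by rewrite mulrDl addrC addrA.
rewrite (_ : Z = [set x; x + b / c]).
  rewrite cards2 -{1}[x]addr0 (inj_eq (addrI x)) eq_sym mulf_eq0 invr_eq0.
  by rewrite (negPf c_nz) orbF; case: eqP.
apply/setP=> t; rewrite !inE fE eqx !mulf_eq0 !subr_eq0.
by rewrite (negPf c_nz) orbF.
Qed.

Definition row3 (a b c : F) : 'rV[F]_3 := \row_j [:: a; b; c]`_j.

Lemma row3_mul a b c (u : 'cV[F]_3) :
  (row3 a b c *m u) 0 0 = a * u 0 0 + b * u 1 0 + c * u (1 + 1) 0.
Proof.
rewrite mxE !big_ord_recl big_ord0 addr0 !mxE /= addrA.
by congr (_ * u _ 0 + _ * u _ 0 + _ * u _ 0); apply: val_inj.
Qed.

Lemma row3_inj a b c a' b' c' :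
  row3 a b c = row3 a' b' c' -> [/\ a = a', b = b' & c = c'].
Proof.
move/rowP=> E; have:= E 0; have := E 1; have:= E (1 + 1).
by rewrite !mxE /= => -> -> ->.
Qed.

Lemma row3Z k a b c : k *: row3 a b c = row3 (k * a) (k * b) (k * c).
Proof.
by apply/rowP=> -[[|[|[|m]]] hm]; rewrite ?mxE.
Qed.

Lemma row3_eq0 a b c : (row3 a b c == 0) = [&& a == 0, b == 0 & c == 0].
Proof.
rewrite -[X in _ == X](scale0r (row3 0 0 0)) row3Z mul0r.
apply/eqP/and3P => [/row3_inj[-> -> ->] | [/eqP-> /eqP-> /eqP->]] //.
Qed.

Lemma odd_card_option (T : finType) (P : pred (option T)) :
  odd #|[set i | P i]| = P None (+) odd #|[set t | P (Some t)]|.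
Proof.
have -> : [set i | P i] =
    (if P None then [set None] else set0) :|: Some @: [set t | P (Some t)].
  apply/setP=> -[t|]; rewrite !inE.
    rewrite mem_imset ?inE; last exact: Some_inj.
    by case: ifP => _; rewrite inE.
  case: ifP => PN; rewrite !inE ?eqxx //.
  by apply/esym/negbTE/imsetP => -[].
rewrite cardsU (_ : _ :&: _ = set0); last first.
  apply/setP=> -[t|]; rewrite !inE.
    by case: ifP; rewrite inE.
  by apply/negbTE; rewrite negb_and; apply/orP; right; apply/imsetP => -[].
rewrite cards0 subn0 card_imset; last exact: Some_inj.
by case: ifP => _; rewrite ?cards1 ?cards0.
Qed.

Lemma odd_card_quadratic_nonroots (a b c : F) :
  odd #|[set t | a + t * b + t ^+ 2 * c != 0]| = (b != 0) (+) (c != 0).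
Proof.
rewrite -(odd_card_quadratic_roots a); set Z := [set t | _ == 0].
rewrite (_ : [set t | _ != 0] = ~: Z); last by apply/setP=> t; rewrite !inE.
by move: F_even; rewrite -(cardsC Z) oddD; case: odd; case: odd.
Qed.

Lemma point_family_line : point_family F #|F|.+1 #|F|.+1.
Proof.
(* The line sits in the plane with third coordinate 0, so that the quadratic count applies with
   [c = 0]. *)
pose p (i : option F) := if i is Some t then row3 1 t 0 else row3 0 1 0.
exists (option F), 3%N, p, setT; split.
- by rewrite card_option.
- by rewrite cardsT card_option.
- by case=> [t|]; rewrite row3_eq0 oner_eq0 ?andbF.
- move=> [t|] [t'|] _ _ neq a; rewrite /= row3Z; apply: contra_neq neq => //.
  + by case/row3_inj=> + ->; rewrite mulr1 => <- _; rewrite mul1r.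
  + by case/row3_inj=> /eqP; rewrite mulr0 oner_eq0.
  by case/row3_inj; rewrite mulr1 => <- /eqP; rewrite mul0r oner_eq0.
move=> u; rewrite odd_card_option /= row3_mul !mul0r mul1r add0r addr0.
set b := u 1 0; have := odd_card_quadratic_nonroots (u 0 0) b 0.
rewrite eqxx addbF => odd_b.
rewrite (_ : [set t | _] = [set t | u 0 0 + t * b + t ^+ 2 * 0 != 0]).
  by rewrite odd_b addbb.
by apply/setP=> t; rewrite !inE row3_mul mul1r mul0r mulr0.
Qed.

Lemma point_family_hyperoval : point_family F #|F|.+2 #|F|.+2.
Proof.
(* The conic points [(1, t, t^2)] and [(0, 0, 1)], together with the nucleus [(0, 1, 0)]. *)
pose p (i : option (option F)) :=
  match i with
  | None => row3 0 0 1
  | Some None => row3 0 1 0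
  | Some (Some t) => row3 1 t (t ^+ 2)
  end.
exists (option (option F)), 3%N, p, setT; split.
- by rewrite !card_option.
- by rewrite cardsT !card_option.
- by case=> [[t|]|]; rewrite row3_eq0 oner_eq0 ?andbF.
- move=> [[t|]|] [[t'|]|] _ _ neq a; rewrite /= row3Z;
    apply: contra_neq neq => //.
  + by case/row3_inj=> + -> _; rewrite mulr1 => <-; rewrite mul1r.
  + by case/row3_inj=> /eqP; rewrite mulr0 oner_eq0.
  + by case/row3_inj=> /eqP; rewrite mulr0 oner_eq0.
  + by case/row3_inj; rewrite mulr1 => <- /eqP; rewrite mul0r oner_eq0.
  + by case/row3_inj=> _ /eqP; rewrite mulr0 oner_eq0.
  + by case/row3_inj; rewrite mulr1 => <- _ /eqP; rewrite mul0r oner_eq0.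
  by case/row3_inj=> _ _ /eqP; rewrite mulr0 oner_eq0.
(* The two points at infinity test the last two coordinates of [u], which cancels the parity of the
   affine part. *)
move=> u; rewrite !odd_card_option /= !row3_mul !mul0r !mul1r !add0r addr0.
under eq_finset => t do rewrite row3_mul mul1r.
by rewrite odd_card_quadratic_nonroots; case: eqP; case: eqP.
Qed.

End Conic.

(** * All lengths above the bound *)

Lemma LPD_large (r n : nat) : (0 < r)%N ->
  (2 ^ (2 * r) - 2 ^ (r - 1) <= n)%N -> LPD 'F_2 r n.
Proof.
case: r => // r _; rewrite subn1 /= => le_n.
have [F F2 cardF] := pPrimePowerField (isT : prime 2) (ltn0Sn r).
pose q := (2 ^ r.+1)%N; pose h := (2 ^ r)%N.
have q2h : q = (2 * h)%N by rewrite /q expnS.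
have h_gt0 : (0 < h)%N by rewrite expn_gt0.
have F_even : ~~ odd #|F| by rewrite cardF expnS oddM.
rewrite mulnC expnM -/q -/h in le_n.
(* [M] is [n / q] rounded up, so that [s = q * M - n] is below [q]. *)
pose M := ((n + q.-1) %/ q)%N.
have [s def_n lt_sq] : exists2 s, n = (q * M - s)%N & (s < q)%N.
  exists (q * M - n)%N.
    have := divn_eq (n + q.-1) q; rewrite -/M mulnC.
    have : ((n + q.-1) %% q < q)%N by rewrite ltn_mod; lia.
    by lia.
  have := divn_eq (n + q.-1) q; rewrite -/M mulnC.
  have : ((n + q.-1) %% q < q)%N by rewrite ltn_mod; lia.
  by lia.
have n_gt0 : (0 < n)%N by nia.
have le_qM : (q <= M)%N by nia.
rewrite def_n; apply: (point_family_LPD F2) => //; first by rewrite -/q; lia.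
(* For [M = q], the hypothesis [q ^ 2 - h <= n] gives [s <= h], exactly what [h] pairs afford. *)
have [eqM | neqM] := eqVneq M q.
  apply: (point_family_weaken (s := h)); first by rewrite eqM in def_n; nia.
  by rewrite eqM q2h mulnC; exact: point_family_pairs.
have := odd_double_half M; case: (boolP (odd M)) => oddM defM.
  apply: (point_family_weaken (s := q.+1 + (M - q.+1)./2)); first by lia.
  rewrite [X in point_family _ X](_ : M = (q.+1 + (M - q.+1)./2 * 2)%N);
    last by lia.
  apply: point_family_add (point_family_pairs _ _).
  by rewrite /q -cardF; exact: point_family_line.
(* As [q] is even, an even [M > q] is at least [q + 2]. *)
apply: (point_family_weaken (s := q.+2 + (M - q.+2)./2)); first by lia.
rewrite [X in point_family _ X](_ : M = (q.+2 + (M - q.+2)./2 * 2)%N);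
    last by lia.
apply: point_family_add (point_family_pairs _ _).
by rewrite /q -cardF; exact: point_family_hyperoval.
Qed.

(** * Existence of a largest non-length *)

(** The single column is nonzero, so some row of [G] is a codeword of weight 1. Hence the set of
    non-lengths is nonempty, as a maximum requires. *)
Lemma not_LPD1 (r : nat) : (0 < r)%N -> ~ LPD 'F_2 r 1.
Proof.
move=> r_gt0 [_ [k [C [_ [G [[_ CE] Gnz _]] C_div]]]].
have /cV0Pn[i Gi] := Gnz 0; rewrite mxE in Gi.
have := C_div (row i G); rewrite CE row_sub card_Fp // => /(_ isT).
rewrite /hamming_weight (_ : [set j | _] = setT).
  rewrite cardsT card_ord dvdn1 -[1%N](expn0 2) eqn_exp2l //.
  by rewrite -leqn0 leqNgt r_gt0.
by apply/setP=> j; rewrite !inE mxE ord1.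
Qed.

(** Descent on [B]; [P] is an arbitrary proposition, so whether it holds at [B.+1] is settled by
    excluded middle. *)
Lemma bounded_largest (P : nat -> Prop) (m0 B : nat) :
    P m0 -> (forall n, P n -> (n <= B)%N) ->
  exists2 m, P m & forall n, P n -> (n <= m)%N.
Proof.
move=> Pm0; elim: B => [|B IHB] leB.
  by exists m0 => // n /leB; rewrite leqn0 => /eqP->.
have [PB | nPB] := classic (P B.+1); first by exists B.+1.
apply: IHB => n Pn; have := leB n Pn; rewrite leq_eqVlt ltnS.
case/orP=> [/eqP eqn | //].
by case: nPB; rewrite -eqn.
Qed.

Local Close Scope ring_scope.

Theorem theorem6 (r : nat) (hr : 2 <= r) :
  exists m : nat,
    is_largest_non_LPD 'F_2 r m /\ m <= 2 ^ (2 * r) - 2 ^ (r - 1) - 1.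
Proof.
have r_gt0 : 0 < r by lia.
have bound n : 0 < n /\ ~ LPD 'F_2 r n -> n <= 2 ^ (2 * r) - 2 ^ (r - 1) - 1.
  case=> n_gt0 notn; rewrite leqNgt; apply/negP => lt_n.
  by apply: notn; apply: LPD_large => //; lia.
have [m [m_gt0 notm] max_m] :=
  bounded_largest (conj (ltn0Sn 0) (not_LPD1 r_gt0)) bound.
exists m; split; last exact: bound.
by split=> // n n_gt0 notn; exact: max_m.
Qed.
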